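(* It holds that $B_{2}^{m} \subsetneqq B_{2}$, i.e. every graph in $B_2^m$ is in $B_2$, and there is a graph in $B_2$ that is not in $B_2^m$.
   Context: All graphs are finite and simple. A grid consists of horizontal grid lines (rows, increasing from bottom to top) and vertical grid lines (columns, increasing from left to right). A grid point is a crossing of two grid lines. A grid edge is the part of a grid line between two consecutive grid points. A path on a grid consists of two grid points (its end points) and a number of consecutive grid edges connecting them. A bend of a path is a turn of the path at a grid point. An EPG representation of a graph $G$ assigns to each vertex $v$ of $G$ a path $P_v$ on a common grid such that two distinct vertices $v,w$ are adjacent in $G$ if and only if $P_v$ and $P_w$ share at least one grid edge. A path is monotonic if it is ascending in both columns and rows, i.e. it has the shape of a staircase going upwards from left to right. For a nonnegative integer $k$, $B_k$ is the class of all graphs that have an EPG representation in which every path has at most $k$ bends, and $B_k^m$ (the superscript $m$ is just a symbol for ''monotonic'') is the class of all graphs that have an EPG representation in which every path is monotonic and has at most $k$ bends. *)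

(* Defs.v *)
From HB Require Import structures.
From mathcomp Require Import all_boot.

Set Implicit Arguments.
Unset Strict Implicit.
Unset Printing Implicit Defensive.

Record sgraph := SGraph {
  vert :> finType;
  adj : rel vert;
  adj_sym : symmetric adj;
  adj_irrefl : irreflexive adj
}.

(* Grid points are pairs (column, row), columns numbered from left to right
   and rows from bottom to top. Only finitely many lines of the grid nat * nat
   are met by the paths representing a finite graph. *)
Definition point : Type := (nat * nat)%type.

Definition grid_adj (a b : point) : bool :=
  ((a.2 == b.2) && ((a.1.+1 == b.1) || (b.1.+1 == a.1))) ||
  ((a.1 == b.1) && ((a.2.+1 == b.2) || (b.2.+1 == a.2))).

(* A path is the list of the grid points it visits, from one end point to the
   other; it is simple and has at least one edge. *)
Definition grid_path (p : seq point) : bool :=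
  [&& 1 < size p, sorted grid_adj p & uniq p].

(* The grid edges of p, each directed as p traverses it. *)
Definition steps (p : seq point) : seq (point * point) := zip p (behead p).

(* Grid edges are undirected: they may be traversed in opposite directions. *)
Definition share_edge (p q : seq point) : bool :=
  has (fun s => (s \in steps q) || ((s.2, s.1) \in steps q)) (steps p).

Definition horizontal (s : point * point) : bool := s.1.2 == s.2.2.

Definition bends (p : seq point) : nat :=
  count (fun t => horizontal t.1 != horizontal t.2)
        (zip (steps p) (behead (steps p))).

Definition ascending (p : seq point) : bool :=
  sorted (fun a b : point => (a.1 <= b.1) && (a.2 <= b.2)) p.

(* Paths are undirected, so p may be listed from either end. *)
Definition monotonic (p : seq point) : bool := ascending p || ascending (rev p).

Definition EPG_rep (G : sgraph) (P : G -> seq point) : Prop :=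
  (forall v : G, grid_path (P v)) /\
  (forall v w : G, v != w -> adj v w = share_edge (P v) (P w)).

Definition B (k : nat) (G : sgraph) : Prop :=
  exists P : G -> seq point,
    EPG_rep P /\ forall v : G, bends (P v) <= k.

Definition Bm (k : nat) (G : sgraph) : Prop :=
  exists P : G -> seq point,
    EPG_rep P /\ forall v : G, monotonic (P v) /\ bends (P v) <= k.

(* Main.v *)
Require Import Defs.
From mathcomp Require Import all_boot.
From mathcomp Require Import zify.

(** A monotonic path with at most two bends is a staircase of at most three
segments. Let X and W be two paths with many pairwise nonadjacent common
neighbours. By pigeonhole two of these, q and q', meet X in the same segment of
X and W in the same segment of W, with the same segments of their own. These
own segments cannot be consecutive, since q and q' would then run through the
same corner; hence they are equal, and X, W and q have a common edge, or they
are the first and the last one. So if X, W, Y have many pairwise nonadjacent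
common neighbours and Y is adjacent neither to X nor to W, then X and W have a
common edge with one of these neighbours.

The separating graph has two rails A_0, A_1 and a clasp P, joined by rungs d_i.
The rungs are pairwise nonadjacent and adjacent to A_0, A_1 and P, the clasp is
adjacent to both rails, and the rails are nonadjacent. For each rung d_i and
each side b there are many pairwise nonadjacent tags adjacent to d_i, P, A_b
and a guard Y_b, but not to A_(1-b); the guards are adjacent to tags only. With
bent-back paths this is easy: A_0 and A_1 lie on rows 1 and 2, P runs along
row 1, turns, and runs back along row 2, so does each d_i on a short interval,
and the tags connect row 1 to Y_0 on row 0, and row 2 to Y_1 on row 3.

In a monotonic representation the rails run on two parallel lines, and each d_i
goes from one to the other. The guards force d_i and P to share, for both b, an
edge outside A_(1-b). For a rung between two others of the same kind the end
segment on the line of A_(1-b) lies inside A_(1-b), so P runs next to such a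
rung on the lines of both rails, over the same interval. No monotonic path does
this. *)

Set Implicit Arguments.
Unset Strict Implicit.
Unset Printing Implicit Defensive.

(** * Staircases and pairwise nonadjacent common neighbours *)

(* (o, c, i) is the unit grid edge from i to i + 1 on the line number c, which
   is a row if o = true and a column if o = false; (o, c, lo, hi) is the set of
   the edges (o, c, i) with lo <= i < hi. *)
Definition edge := (bool * nat * nat)%type.
Definition segment := (bool * nat * nat * nat)%type.

Definition on_seg (s : segment) (e : edge) : bool :=
  [&& e.1.1 == s.1.1.1, e.1.2 == s.1.1.2, s.1.2 <= e.2 & e.2 < s.2].

(* If dir = true, the path (c0, r0) -- (c1, r0) -- (c1, r1) -- (c2, r1), with
   columns first; if dir = false, its transpose. No order is imposed on the
   fields: a segment with hi <= lo is empty. *)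
Record staircase := Staircase
  { dir : bool; c0 : nat; c1 : nat; c2 : nat; r0 : nat; r1 : nat }.

(* The first, middle and last segments are indexed by Some false, None and
   Some true. *)
Definition seg (q : staircase) (l : option bool) : segment :=
  match l with
  | Some false => (dir q, r0 q, c0 q, c1 q)
  | None => (~~ dir q, c1 q, r0 q, r1 q)
  | Some true => (dir q, r1 q, c1 q, c2 q)
  end.

Definition on (q : staircase) (e : edge) := exists l, on_seg (seg q l) e.

Definition meet (s s' : segment) := exists e, on_seg s e /\ on_seg s' e.

Lemma pigeonhole (C I : finType) (R : I -> C -> Prop) (m : nat) :
  #|C| * m < #|I| -> (forall i, exists c, R i c) ->
  exists c, exists2 D : {set I}, m < #|D| & forall i, i \in D -> R i c.
Proof.
move=> lt_m /fin_all_exists[f Rf].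
case: (pickP (fun c => m < #|[set i | f i == c]|)) => [c lt_c | le_m].
  exists c, [set i | f i == c] => // i; rewrite inE => /eqP <-; exact: Rf.
move: lt_m; rewrite ltnNge => /negP[].
rewrite -sum1_card (partition_big f predT) //= -sum_nat_const.
apply: leq_sum => c _; rewrite sum1dep_card leqNgt; exact/negbT/le_m.
Qed.

Lemma meetP s s' :
  meet s s' <-> s.1.1 = s'.1.1 /\ maxn s.1.2 s'.1.2 < minn s.2 s'.2.
Proof.
case: s s' => [[[o c] lo] hi] [[[o' c'] lo'] hi']; rewrite /meet /on_seg /=.
split=> [[[[? ?] ?] [/= /and4P[/eqP-> /eqP-> ? ?] /and4P[/eqP-> /eqP-> ? ?]]] | [[-> ->] ?]].
  by split=> //; lia.
by exists (o', c', maxn lo lo') => /=; rewrite !eqxx /=; lia.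
Qed.

(** All four lie on one line, and an interval that meets both of the disjoint intervals [s1] and
    [s2] contains the edge of [s1] nearest to [s2]. *)
Lemma common_edge s1 s2 sX sW :
  ~ meet s1 s2 -> meet s1 sX -> meet s2 sX -> meet s1 sW -> meet s2 sW ->
  exists e, [/\ on_seg s1 e, on_seg sX e & on_seg sW e].
Proof.
case: s1 s2 sX sW => [[ln1 lo] hi] [[ln2 lo'] hi'] [[lnX loX] hiX] [[lnW loW] hiW].
rewrite !meetP /= => D [E1 ?] [E2 ?] [E3 ?] [E4 ?]; subst ln1 ln2 lnX.
have {}D : ~~ (maxn lo lo' < minn hi hi') by apply/negP => ?; apply: D.
exists (lnW, if hi <= lo' then hi.-1 else lo).
by rewrite /on_seg /= !eqxx /=; case: ifP => ?; split; lia.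
Qed.

Definition touch q1 q2 := exists e, on q1 e /\ on q2 e.

(** The middle segments lie on the line of [sX] and the end segments on that of [sW], so the corners
    coincide and both end segments contain the edge next to the corner. *)
Lemma no_common_corner q1 q2 sX sW b :
  ~ touch q1 q2 ->
  meet (seg q1 None) sX -> meet (seg q2 None) sX ->
  meet (seg q1 (Some b)) sW -> meet (seg q2 (Some b)) sW -> False.
Proof.
case: q1 q2 sX sW => [t u0 u1 u2 v0 v1] [t' u0' u1' u2' v0' v1'].
move=> [[lnX loX] hiX] [[lnW loW] hiW] dis; rewrite !meetP /=.
move=> [<- ?] [[/negb_inj ? ?] ?]; subst t' u1'; case: b => /= -[<- ?] [[? ?]]; subst.
- apply: dis; exists (t, v1, u1); split; exists (Some true); rewrite /on_seg /= !eqxx; lia.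
- apply: dis; exists (t, v0, u1.-1); split; exists (Some false); rewrite /on_seg /= !eqxx; lia.
Qed.

Lemma common_neighbours q1 q2 sX sW l l' :
  ~ touch q1 q2 ->
  meet (seg q1 l) sX -> meet (seg q2 l) sX ->
  meet (seg q1 l') sW -> meet (seg q2 l') sW ->
  (l = l' /\ exists e, [/\ on_seg (seg q1 l) e, on_seg sX e & on_seg sW e])
  \/ exists b, l = Some b /\ l' = Some (~~ b).
Proof.
move=> dis m1 m2 m3 m4.
case: (eqVneq l l') => [El | nl].
  left; split=> //; subst l'; apply: common_edge m1 m2 m3 m4 => -[e [e1 e2]].
  by apply: dis; exists e; split; exists l.
right; case: l l' nl m1 m2 m3 m4 => [b|] [b'|] // nl m1 m2 m3 m4.
- by exists b; split=> //; congr Some; case: b b' nl {m1 m2 m3 m4} => -[].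
- by case: (no_common_corner dis m3 m4 m1 m2).
- by case: (no_common_corner dis m1 m2 m3 m4).
Qed.

Lemma triple_edge (I : finType) (q : I -> staircase) X W Y :
  9 ^ 3 < #|I| -> (forall i j, i != j -> ~ touch (q i) (q j)) ->
  ~ touch X Y -> ~ touch W Y ->
  (forall i, [/\ touch (q i) X, touch (q i) W & touch (q i) Y]) ->
  exists i, exists e, [/\ on (q i) e, on X e & on W e].
Proof.
move=> ltI dis dXY dWY nbr.
pose C : finType := ((option bool * option bool) * (option bool * option bool)
                * (option bool * option bool))%type.
pose R i (c : C) := [/\ meet (seg (q i) c.1.1.1) (seg X c.1.1.2),
  meet (seg (q i) c.1.2.1) (seg W c.1.2.2) & meet (seg (q i) c.2.1) (seg Y c.2.2)].
(* Each of [X], [W], [Y] gives 3 * 3 choices of a pair of segments. *)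
have [||c [D]] := @pigeonhole C I R 1.
- by rewrite muln1 !card_prod !card_option card_bool.
- move=> i; have [[e1 [[l1 ?] [k1 ?]]] [e2 [[l2 ?] [k2 ?]]] [e3 [[l3 ?] [k3 ?]]]] := nbr i.
  by exists (l1, k1, (l2, k2), (l3, k3)); split; [exists e1 | exists e2 | exists e3].
case/card_gt1P=> i [j [Di Dj nij]] RD.
have [X1 W1 Y1] := RD i Di; have [X2 W2 Y2] := RD j Dj.
have [[_ [e [? ? ?]]] | [b [Eb Eb']]] := common_neighbours (dis i j nij) X1 X2 W1 W2.
  by exists i, e; split; eexists; eassumption.
have [[_ [e [? ? ?]]] | [b' [Eb1 Eb1']]] := common_neighbours (dis i j nij) X1 X2 Y1 Y2.
  by case: dXY; exists e; split; eexists; eassumption.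
have [[_ [e [? ? ?]]] | [b2 [Eb2 Eb2']]] := common_neighbours (dis i j nij) W1 W2 Y1 Y2.
  by case: dWY; exists e; split; eexists; eassumption.
(* Three segments of one staircase cannot be pairwise opposite ends. *)
by move: Eb' Eb1 Eb1' Eb2 Eb2'; rewrite Eb => -> [<-] -> [<-] []; case: b {Eb}.
Qed.

(** * Rungs between two parallel rails *)

(** The two end segments lie on opposite sides of [c1 q]. A path that bends back fails here. *)
Lemma on_monotone q o c c' i : on q (o, c, i) -> on q (o, c', i) -> c = c'.
Proof.
by case=> [[[]|]] /and4P[/= /eqP-> /eqP-> ? ?] [[[]|]] /and4P[/= /eqP ? /eqP-> ? ?]; lia.
Qed.

Lemma not_touch_seg q q' l : ~ touch q q' ->
  (seg q l).1.1 = (seg q' l).1.1 ->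
  ~~ (maxn (seg q l).1.2 (seg q' l).1.2 < minn (seg q l).2 (seg q' l).2).
Proof.
move=> d El; apply/negP => lt; apply: d.
by have [e [? ?]] := (meetP _ _).2 (conj El lt); exists e; split; exists l.
Qed.

(** The three end segments follow one another on the line of [s], which reaches both outer ones. The
    edge at [c1 q2] starts the last segment or comes just after the first one; its position is the
    same for both values of [b], as [on_monotone] requires. *)
Lemma straddle q1 q2 q3 b s :
  ~ touch q1 q2 -> ~ touch q2 q3 -> c1 q1 <= c1 q2 <= c1 q3 ->
  meet (seg q1 (Some b)) s -> meet (seg q2 (Some b)) s ->
  meet (seg q3 (Some b)) s ->
  (forall e, on_seg (seg q2 (Some b)) e -> on_seg s e) /\
  on_seg s (dir q2, if b then r1 q2 else r0 q2, c1 q2).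
Proof.
move=> /(not_touch_seg (l := Some b)) D1 /(not_touch_seg (l := Some b)) D2 le_a.
move=> /meetP[E1 M1] /meetP[E2 M2] /meetP[E3 M3]; move: D1 D2 M1 M2 M3.
rewrite E1 E2 E3 => /(_ erefl) + /(_ erefl); move: le_a E2 {E1 E3}.
case: q1 q2 q3 s => [? ? ? ? ? ?] [? ? ? ? ? ?] [? ? ? ? ? ?] [[ln lo] hi].
rewrite !(gtn_max, leq_max, leq_min, gtn_min, geq_min, geq_max) /on_seg /=.
case: b => /= le_a <- D1 D2 M1 M2 M3; rewrite /= !eqxx /=; (split; last by lia).
  by move=> e /and4P[-> -> ? ?]; lia.
by move=> e /and4P[-> -> ? ?]; lia.
Qed.

Lemma sorted_triple (I : finType) (D : {set I}) (key : I -> nat) :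
  2 < #|D| -> exists x y z,
    [/\ x \in D, y \in D & z \in D] /\ [/\ x != y, y != z & key x <= key y <= key z].
Proof.
case/card_gt2P=> x [y [z [[Dx Dy Dz] [nxy nyz nzx]]]].
have S u v : u != v -> v != u by rewrite eq_sym.
case: (leqP (key x) (key y)) => [?|/ltnW ?]; case: (leqP (key y) (key z)) => [?|/ltnW ?];
  case: (leqP (key z) (key x)) => [?|/ltnW ?].
- by exists x, y, z; do !split=> //; lia.
- by exists x, y, z; do !split=> //; lia.
- by exists z, x, y; do !split; auto; lia.
- by exists x, z, y; do !split; auto; lia.
- by exists y, z, x; do !split; auto; lia.
- by exists y, x, z; do !split; auto; lia.
- by exists z, y, x; do !split; auto; lia.
- by exists z, y, x; do !split; auto; lia.
Qed.

(* A is the pair of rails, d the rungs and P the clasp. *)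
Lemma no_double_crossing (I : finType) (A : bool -> staircase) P (d : I -> staircase) :
  9 ^ 4 * 2 < #|I| -> (forall i j, i != j -> ~ touch (d i) (d j)) ->
  ~ touch (A false) (A true) -> (forall b i, touch (d i) (A b)) ->
  (forall b i, exists e, [/\ on (d i) e, on P e & ~ on (A (~~ b)) e]) -> False.
Proof.
move=> ltI dis dA tA tP.
pose C1 : finType := ((option bool * option bool) * (option bool * option bool))%type.
pose C : finType := {ffun bool -> C1}.
pose R i (c : C) := forall b,
  meet (seg (d i) (c b).1.1) (seg (A b) (c b).1.2) /\
  exists e, [/\ on_seg (seg (d i) (c b).2.1) e, on_seg (seg P (c b).2.2) e & ~ on (A (~~ b)) e].
(* There are 9 ^ 2 colours for each side, and three rungs of one colour are wanted. *)
have [||c [D]] := @pigeonhole C I R 2.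
- by rewrite card_ffun !card_prod !card_option card_bool.
- move=> i; suff /fin_all_exists[g Rg] : forall b, exists x : C1,
     meet (seg (d i) x.1.1) (seg (A b) x.1.2) /\
     exists e, [/\ on_seg (seg (d i) x.2.1) e, on_seg (seg P x.2.2) e & ~ on (A (~~ b)) e].
    by exists (finfun g) => b; rewrite ffunE; exact: Rg.
  move=> b; have [e1 [[l1 ?] [k1 ?]]] := tA b i; have [e2 [[l2 ?] [k2 ?] ?]] := tP b i.
  by exists ((l1, k1), (l2, k2)); split; [exists e1 | exists e2].
case/(sorted_triple (fun i => c1 (d i))) => x [y [z [[Dx Dy Dz] [nxy nyz le_a]]]] RD.
have [Rx Ry Rz] := And3 (RD x Dx) (RD y Dy) (RD z Dz).
have [dxy dyz] := conj (dis x y nxy) (dis y z nyz).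
pose l b := (c b).1.1; pose m b := (c b).2.1.
pose sA b := seg (A b) (c b).1.2; pose sP b := seg P (c b).2.2.
have mA i b : i \in D -> meet (seg (d i) (l b)) (sA b) by case/RD/(_ b).
have mP i b : i \in D -> meet (seg (d i) (m b)) (sP b).
  by case/RD/(_ b) => _ [e [? ? _]]; exists e.
have [bb lE] : exists bb, forall b, l b = Some (b (+) bb).
  have [[_ [e [_ ? ?]]]|[b [E1 E2]]] := common_neighbours dxy (mA x false Dx) (mA y false Dy)
           (mA x true Dx) (mA y true Dy).
    by case: dA; exists e; split; eexists; eassumption.
  by exists b => -[].
have inA b e : on_seg (seg (d y) (l b)) e -> on (A b) e.
  move=> ye; exists (c b).1.2.
  have := mA x b Dx; have := mA y b Dy; have := mA z b Dz; move: ye; rewrite lE.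
  move=> ye mz my mx; exact: (straddle dxy dyz le_a mx my mz).1.
have mE b : m b = l b.
  have [[//]|[b' [E1 E2]]] := common_neighbours dxy (mP x b Dx) (mP y b Dy) (mA x b Dx) (mA y b Dy).
  have [_ [e [ye _ []]]] := Ry b; apply: inA; move: ye E2; rewrite -/(m b) E1 !lE.
  (* Otherwise the clasp edge of [d y] lies on its opposite end segment, which is inside the other
     rail. *)
  by move=> + [E2]; suff -> : ~~ b (+) bb = b' by []; case: b b' bb E2 {lE E1} => -[] [].
pose f b : edge := (dir (d y), if b then r1 (d y) else r0 (d y), c1 (d y)).
have cross s b : (forall i, i \in D -> meet (seg (d i) (l b)) s) -> on_seg s (f (b (+) bb)).
  rewrite lE => M; exact: (straddle dxy dyz le_a (M x Dx) (M y Dy) (M z Dz)).2.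
have onP b : on P (f b).
  exists (c (b (+) bb)).2.2; rewrite -[b in f b](addbK bb).
  by apply: cross => i; rewrite -mE; exact: mP.
(* Both edges are on [P] at the same position, so they coincide, in an edge common to the two
   rails. *)
have eq_f : f false = f true by rewrite /f (on_monotone (onP false) (onP true)).
have onA b : on (A b) (f true).
  exists (c b).1.2; have : on_seg (sA b) (f (b (+) bb)) by apply: cross => i; exact: mA.
  by case: (b (+) bb); rewrite ?eq_f.
by apply: dA; exists (f true).
Qed.

(** * From grid paths to staircases *)

Definition ends (e : edge) : point * point :=
  let: (o, c, i) := e in
  if o then ((i, c), (i.+1, c)) else ((c, i), (c, i.+1)).

Definition swap (s : point * point) := (s.2, s.1).

Definition used (p : seq point) (e : edge) : bool :=
  (ends e \in steps p) || (swap (ends e) \in steps p).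

Lemma steps_rcons p a b : steps (rcons (rcons p a) b) = rcons (steps (rcons p a)) (a, b).
Proof. by elim: p => [|x [|y p] IHp] //=; rewrite -IHp. Qed.

Lemma steps_cat p a b q :
  steps (rcons p a ++ b :: q) = steps (rcons p a) ++ (a, b) :: steps (b :: q).
Proof. by elim: p => [|x [|y p] IHp] //=; congr cons; exact: IHp. Qed.

Lemma steps_rev p : steps (rev p) = rev (map swap (steps p)).
Proof.
elim: p => [|x [|y p] IHp] //.
rewrite rev_cons rev_cons steps_rcons -rev_cons IHp.
by rewrite -[steps [:: x, y & p]]/((x, y) :: steps (y :: p)) map_cons rev_cons.
Qed.

Lemma mem_steps_rev p s : (s \in steps (rev p)) = (swap s \in steps p).
Proof.
have swapK : involutive swap by case.
by rewrite steps_rev mem_rev -[s in LHS]swapK mem_map //; exact: inv_inj.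
Qed.

Lemma used_rev p e : used (rev p) e = used p e.
Proof. by rewrite /used !mem_steps_rev orbC /swap /=; case: (ends e). Qed.

Lemma steps_sorted (r : rel point) p s : sorted r p -> s \in steps p -> r s.1 s.2.
Proof.
elim: p => [|x [|y p] IHp] //= /andP[rxy /IHp{}IHp].
by rewrite inE => /orP[/eqP-> //|/IHp].
Qed.

Lemma share_edgeP p q : grid_path p ->
  reflect (exists e, used p e /\ used q e) (share_edge p q).
Proof.
case/and3P=> _ p_adj _; apply: (iffP hasP) => [[s ps qs] | [e [/orP[pe|pe] qe]]].
- have [e /orP[/eqP Es|/eqP Es]] : exists e, (s == ends e) || (s == swap (ends e)).
    have := steps_sorted p_adj ps; case: s {ps qs} => -[x y] [x' y'] /=.
    rewrite /grid_adj /=.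
    case/orP=> /andP[/eqP <- /orP[/eqP<-|/eqP<-]].
    + by exists (true, y, x); rewrite eqxx.
    + by exists (true, y, x'); rewrite eqxx orbT.
    + by exists (false, x, y); rewrite eqxx.
    + by exists (false, x, y'); rewrite eqxx orbT.
  + by exists e; rewrite /used -Es ps.
  + exists e; rewrite /used -Es ps orbT; split=> //; move: qs; rewrite Es orbC.
    by case: (ends e).
- by exists (ends e).
- by exists (swap (ends e)) => //; move: qe; rewrite /used orbC; case: (ends e).
Qed.

Definition turns (w : seq bool) : nat := count (fun t => t.1 != t.2) (zip w (behead w)).

Lemma bends_turns p : bends p = turns (map horizontal (steps p)).
Proof.
rewrite /bends /turns behead_map; move: (steps p) (behead _) => s t.
by elim: s t => [|x s IHs] [|y t] //=; rewrite IHs.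
Qed.

Lemma turns_cons t t' w : turns [:: t, t' & w] = (t != t') + turns (t' :: w).
Proof. by []. Qed.

Lemma turns_split t w : exists i w', t :: w = nseq i.+1 t ++ w' /\
  (w' = [::] \/ exists2 v, w' = ~~ t :: v & turns (t :: w) = (turns w').+1).
Proof.
elim: w t => [|t' w IHw] t; first by exists 0, [::]; split; [|left].
rewrite turns_cons; have [<-|ntt'] := eqVneq t t'.
  by have [i [w' [-> E]]] := IHw t; exists i.+1, w'.
exists 0, (t' :: w); split=> //; right; exists w => //.
by congr cons; case: t t' ntt' => -[].
Qed.

Lemma turns_le2 w : turns w <= 2 ->
  exists t i j k, w = nseq i t ++ nseq j (~~ t) ++ nseq k t.
Proof.
case: w => [|t w]; first by exists true, 0, 0, 0.
have [i [w1 [-> [->|[v1 -> ->]]]]] := turns_split t w.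
  by exists t, i.+1, 0, 0; rewrite cats0.
have [j [w2 [-> [->|[v2 -> ->]]]]] := turns_split (~~ t) v1.
  by exists t, i.+1, j.+1, 0; rewrite cats0.
rewrite negbK; have [k [w3 [-> [->|[v3 -> ->]]]]] := turns_split t v2.
  by exists t, i.+1, j.+1, k.+1; rewrite cats0.
by [].
Qed.

Lemma turns_cat u v : turns (u ++ v) <= (turns u + turns v).+1.
Proof.
elim: u v => [|t [|t' u] IHu] v; last by move: (IHu v); rewrite !cat_cons !turns_cons; lia.
- by rewrite leqnSn.
- by case: v => // t' v; rewrite cat_cons turns_cons; case: (_ != _) => /=; lia.
Qed.

Lemma turns_rev w : turns (rev w) = turns w.
Proof.
have turns_rcons v t t' : turns (rcons (rcons v t) t') = turns (rcons v t) + (t != t').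
  elim: v => [|u [|u' v] IHv]; first by rewrite turns_cons addnC.
    by rewrite !turns_cons /turns /= !addn0.
  by move: IHv; rewrite !rcons_cons !turns_cons => ->; rewrite addnA.
elim: w => [|t [|t' w] IHw] //.
by rewrite !rev_cons turns_rcons -rev_cons IHw turns_cons addnC eq_sym.
Qed.

Lemma turns_nseq n t : turns (nseq n t) = 0.
Proof. by elim: n => [|[|n] IHn] //=; rewrite turns_cons eqxx. Qed.

Lemma bends_rev p : bends (rev p) = bends p.
Proof.
rewrite !bends_turns steps_rev map_rev turns_rev -map_comp; congr turns.
by apply: eq_map => s; rewrite /horizontal /= eq_sym.
Qed.

Definition advance (a : point) (t : bool) : point :=
  if t then (a.1.+1, a.2) else (a.1, a.2.+1).

Definition walk a w := a :: scanl advance a w.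

Definition coord (t : bool) (a : point) := if t then a.1 else a.2.

Lemma walk_cons a t w : walk a (t :: w) = a :: walk (advance a t) w.
Proof. by []. Qed.

Lemma steps_walk_cons a t w :
  steps (walk a (t :: w)) = (a, advance a t) :: steps (walk (advance a t) w).
Proof. by []. Qed.

Lemma horizontal_walk a w : map horizontal (steps (walk a w)) = w.
Proof.
elim: w a => // t w IHw a; rewrite steps_walk_cons map_cons IHw.
by congr cons; case: a => x y; case: t; rewrite /horizontal /= ?eqxx //; lia.
Qed.

Lemma ascending_walk a p : sorted grid_adj (a :: p) -> ascending (a :: p) ->
  exists w, a :: p = walk a w.
Proof.
elim: p a => [|b p IHp] a; first by exists [::].
rewrite /= => /andP[adj_ab sp] /andP[/andP[le1 le2] ap].
have [w Ew] := IHp b sp ap.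
have [t Et] : exists t, b = advance a t.
  move: adj_ab le1 le2; case: a b {IHp sp ap Ew} => [x y] [x' y']; rewrite /grid_adj /=.
  case/orP=> /andP[/eqP <- /orP[/eqP<-|/eqP<-]] ? ?; try lia.
    by exists true.
  by exists false.
by exists (t :: w); rewrite walk_cons -Et -Ew.
Qed.

Lemma ends_advance e a t :
  (ends e == (a, advance a t)) = on_seg (t, coord (~~ t) a, coord t a, (coord t a).+1) e.
Proof. by case: e a t => [[[] c] i] [x y] []; rewrite /on_seg /= ?xpair_eqE; lia. Qed.

Lemma used_walk a w e : used (walk a w) e = (ends e \in steps (walk a w)).
Proof.
rewrite /used; suff -> : (swap (ends e) \in steps (walk a w)) = false by rewrite orbF.
elim: w a => // t w IHw a; rewrite steps_walk_cons inE IHw orbF.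
by case: e a t {IHw} => [[[] c] i] [x y] []; rewrite /= xpair_eqE !xpair_eqE; lia.
Qed.

Lemma used_walk_nseq a i t w e :
  used (walk a (nseq i t ++ w)) e =
  on_seg (t, coord (~~ t) a, coord t a, coord t a + i) e ||
  used (walk (iter i (advance^~ t) a) w) e.
Proof.
rewrite !used_walk; elim: i a => [|i IHi] a.
  by rewrite /on_seg /= addn0; case: (_ \in _); rewrite ?orbT //; lia.
rewrite [nseq _ _ ++ _]/= steps_walk_cons inE IHi iterSr orbA ends_advance; congr orb.
by case: e a t {IHi} => [[o c] j] [x y] []; rewrite /on_seg /=; lia.
Qed.

Lemma coord_iter a i t : coord t (iter i (advance^~ t) a) = coord t a + i.
Proof.
have advE p : coord t (advance p t) = (coord t p).+1 by case: t.
by elim: i => [|i IHi]; rewrite ?addn0 // iterS advE IHi addnS.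
Qed.

Lemma coordN_iter a i t : coord (~~ t) (iter i (advance^~ t) a) = coord (~~ t) a.
Proof.
have advE p : coord (~~ t) (advance p t) = coord (~~ t) p by case: t.
by elim: i => [|i IHi] //; rewrite iterS advE.
Qed.

Lemma monotonic_staircase p : grid_path p -> monotonic p -> bends p <= 2 ->
  exists q, forall e, used p e <-> on q e.
Proof.
wlog asc : p / ascending p.
  move=> IH gp /orP[asc|asc]; first by apply: IH; rewrite // /monotonic asc.
  rewrite -bends_rev => le2; have [||q Eq] := IH _ asc _ _ le2.
  - case/and3P: gp => sz_p adj_p uniq_p.
    rewrite /grid_path size_rev rev_uniq rev_sorted sz_p uniq_p andbT.
    by apply: sub_sorted adj_p => x y; rewrite /grid_adj /=; lia.
  - by rewrite /monotonic asc.
  - by exists q => e; rewrite -Eq used_rev.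
case: p asc => [|a p] // asc /and3P[_ adj_p _] _.
have [w ->] := ascending_walk adj_p asc.
rewrite bends_turns horizontal_walk => /turns_le2[t [i [j [k ->]]]].
(* A run of length 0 becomes an empty segment. *)
exists (Staircase t (coord t a) (coord t a + i) (coord t a + i + k)
  (coord (~~ t) a) (coord (~~ t) a + j)) => e.
have coordP b n : coord t (iter n (advance^~ (~~ t)) b) = coord t b.
  by rewrite -{1}[t]negbK coordN_iter negbK.
rewrite -[nseq k t]cats0 !used_walk_nseq used_walk orbF negbK.
rewrite !(coordP, coord_iter, coordN_iter).
split=> [/or3P[?|?|?]|[[[]|] ?]].
- by exists (Some false).
- by exists None.
- by exists (Some true).
- by apply/or3P/Or33.
- by apply/or3P/Or31.
- by apply/or3P/Or32.
Qed.

(** * Bent-back paths *)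

(* From (c + w0, r) left to (c, r), up to (c, r + 1), right to (c + w1, r + 1). *)
Definition hook (c r w0 w1 : nat) : seq point :=
  rev (walk (c, r) (nseq w0 true)) ++ walk (c, r.+1) (nseq w1 true).

Lemma steps_hook c r w0 w1 : steps (hook c r w0 w1) =
  steps (rev (walk (c, r) (nseq w0 true)))
    ++ ((c, r), (c, r.+1)) :: steps (walk (c, r.+1) (nseq w1 true)).
Proof. by rewrite /hook /walk rev_cons steps_cat. Qed.

Lemma used_hook c r w0 w1 e : used (hook c r w0 w1) e =
  [|| on_seg (true, r, c, c + w0) e, on_seg (false, c, r, r.+1) e
    | on_seg (true, r.+1, c, c + w1) e].
Proof.
have usedE w r' : used (walk (c, r') (nseq w true)) e = on_seg (true, r', c, c + w) e.
  by rewrite -[nseq w true]cats0 used_walk_nseq used_walk orbF.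
have stepE : on_seg (false, c, r, r.+1) e =
    (ends e == ((c, r), (c, r.+1))) || (swap (ends e) == ((c, r), (c, r.+1))).
  by case: e {usedE} => [[[] l] i]; rewrite /on_seg /= !xpair_eqE; lia.
rewrite stepE -!usedE -(used_rev (walk (c, r) _)) /used !steps_hook !mem_cat !inE.
by case: (ends e \in _); case: (swap _ \in _); case: (ends e == _);
  case: (ends e \in _); case: (swap _ == _).
Qed.

Lemma bends_hook c r w0 w1 : bends (hook c r w0 w1) <= 2.
Proof.
rewrite bends_turns steps_hook map_cat map_cons horizontal_walk.
rewrite steps_rev map_rev -map_comp.
rewrite (eq_map (_ : horizontal \o swap =1 horizontal)); last first.
  by move=> s; rewrite /horizontal /= eq_sym.
rewrite horizontal_walk rev_nseq.
apply: leq_trans (turns_cat _ _) _; rewrite turns_nseq add0n ltnS.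
by apply: leq_trans (turns_cat [:: _] _) _; rewrite turns_nseq.
Qed.

Lemma sorted_walk a w : sorted grid_adj (walk a w).
Proof.
elim: w a => // t w IHw a; rewrite walk_cons /= [path _ _ _]IHw andbT.
by case: a t {IHw} => x y []; rewrite /grid_adj /= !eqxx ?orbT.
Qed.

Lemma walk_row c r w : walk (c, r) (nseq w true) = [seq (i, r) | i <- iota c w.+1].
Proof. by elim: w c => //= w IHw c; congr cons; exact: IHw. Qed.

Lemma sorted_rcons_cat (T : Type) (r : rel T) p a b q :
  sorted r (rcons p a ++ b :: q) = [&& sorted r (rcons p a), r a b & path r b q].
Proof. by case: p => //= x p; rewrite cat_path last_rcons. Qed.

Lemma grid_path_hook c r w0 w1 : grid_path (hook c r w0 w1).
Proof.
apply/and3P; split.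
- by rewrite size_cat size_rev /walk /= addnS addSn.
- rewrite /hook {1}/walk rev_cons sorted_rcons_cat -rev_cons rev_sorted.
  have adj_sym x y : grid_adj x y = grid_adj y x by rewrite /grid_adj; lia.
  rewrite (eq_sorted (_ : _ =2 grid_adj)) ?sorted_walk //.
  by rewrite /grid_adj /= !eqxx orbT [path _ _ _]sorted_walk.
- rewrite cat_uniq rev_uniq !walk_row !map_inj_uniq ?iota_uniq => [|? ? []|? ? []] //.
  rewrite andbT.
  by apply/hasPn => _ /mapP[x _ ->]; rewrite mem_rev; apply/mapP => -[y _ [_]]; lia.
Qed.

(** One clause for each pair of rows, and one for the vertical edges. *)
Lemma share_hook c r w0 w1 c' r' w0' w1' :
  share_edge (hook c r w0 w1) (hook c' r' w0' w1') =
  [|| (r == r') && (maxn c c' < minn (c + w0) (c' + w0')),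
      (r == r'.+1) && (maxn c c' < minn (c + w0) (c' + w1')),
      (r.+1 == r') && (maxn c c' < minn (c + w1) (c' + w0')),
      (r == r') && (maxn c c' < minn (c + w1) (c' + w1'))
    | (r == r') && (c == c')].
Proof.
apply/(share_edgeP _ (grid_path_hook _ _ _ _))/idP => [[[[o l] i]] | ].
  by rewrite !used_hook /on_seg /=; case: o => /=; lia.
case/or4P=> [/andP[/eqP Er lt]|/andP[/eqP Er lt]|/andP[/eqP Er lt]|/orP[/andP[/eqP Er lt]|/andP[/eqP Er /eqP Ec]]].
- by exists (true, r, maxn c c'); rewrite !used_hook /on_seg /=; lia.
- by exists (true, r, maxn c c'); rewrite !used_hook /on_seg /=; lia.
- by exists (true, r', maxn c c'); rewrite !used_hook /on_seg /=; lia.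
- by exists (true, r.+1, maxn c c'); rewrite !used_hook /on_seg /=; lia.
- by exists (false, c, r); rewrite !used_hook /on_seg /=; lia.
Qed.

(** * The separating graph *)

Section Graph.

Variables n k : nat.

Definition gvert : finType := (bool + bool + unit + 'I_n + bool * 'I_n * 'I_k)%type.

Definition rail (b : bool) : gvert := inl (inl (inl (inl b))).
Definition guard (b : bool) : gvert := inl (inl (inl (inr b))).
Definition clasp : gvert := inl (inl (inr tt)).
Definition rung (i : 'I_n) : gvert := inl (inr i).
Definition tag (b : bool) (i : 'I_n) (j : 'I_k) : gvert := inr (b, i, j).

Definition arc (u v : gvert) : bool :=
  match u, v with
  | inl (inl (inl (inl _))), inl (inl (inr _)) => true
  | inl (inl (inl (inl _))), inl (inr _) => true
  | inl (inl (inl (inl b))), inr (b', _, _) => b == b'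
  | inl (inl (inl (inr b))), inr (b', _, _) => b == b'
  | inl (inl (inr _)), inl (inr _) => true
  | inl (inl (inr _)), inr _ => true
  | inl (inr i), inr (_, i', _) => i == i'
  | _, _ => false
  end.

Definition gadj (u v : gvert) := arc u v || arc v u.

Lemma gadj_sym : symmetric gadj.
Proof. by move=> u v; exact: orbC. Qed.

Lemma gadj_irrefl : irreflexive gadj.
Proof. by case=> [[[[]|]|]|[[]]]. Qed.

Definition ladder := SGraph gadj_sym gadj_irrefl.

(* The unused row of a rail or a guard has width 0, so that it only adds a
   private vertical edge in column 0 or 1. *)
Definition ladder_path (v : gvert) : seq point :=
  match v with
  | inl (inl (inl (inl b))) => if b then hook 0 2 (2 + n * k) 0 else hook 0 0 0 (2 + n * k)
  | inl (inl (inl (inr b))) => if b then hook 1 2 0 (2 + n * k) else hook 1 0 (2 + n * k) 0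
  | inl (inl (inr _)) => hook 0 1 (2 + n * k) (2 + n * k)
  | inl (inr i) => hook (2 + i * k) 1 k k
  | inr (b, i, j) => hook (2 + i * k + j) (if b then 2 else 0) 1 1
  end.

(** Columns 0 and 1 keep the vertical edges of rails, clasp and guards apart. From column 2 on, each
    rung has its own block of [k] columns, with one column per tag on each side. *)
Lemma ladder_B2 : 0 < k -> B 2 ladder.
Proof.
move=> k_gt0; exists ladder_path; split; last first.
  by case=> [[[[[]|[]]|u]|i]|[[b i] j]]; exact: bends_hook.
split; first by case=> [[[[[]|[]]|u]|i]|[[b i] j]]; exact: grid_path_hook.
(* The facts about products are settled first, so that [lia] can treat [i * k] as an atom. *)
have apart (i i' : 'I_n) :
    [\/ i = i', i * k + k <= i' * k /\ i != i' | i' * k + k <= i * k /\ i != i'].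
  case: (ltngtP i i') => [lt|lt|/val_inj->]; last by constructor 1.
    by constructor 2; rewrite addnC -mulSn leq_mul2r lt orbT neq_ltn lt.
  by constructor 3; rewrite addnC -mulSn leq_mul2r lt orbT neq_ltn lt orbT.
have inside (i : 'I_n) : i * k + k <= n * k.
  by rewrite addnC -mulSn leq_mul2r ltn_ord orbT.
have tag_neq b (i i' : 'I_n) (j j' : 'I_k) :
    tag b i j != tag b i' j' -> i = i' -> j <> j' :> nat.
  by move=> + Ei /val_inj Ej; rewrite Ei Ej eqxx.
case=> [[[[[]|[]]|[]]|i]|[[[] i] j]] [[[[[]|[]]|[]]|i']|[[[] i'] j']] nuv //=.
all: rewrite /gadj /arc /ladder_path share_hook //=.
all: try have Li := inside i; try have Li' := inside i'; try have Bl := apart i i'.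
all: try have Lj := ltn_ord j; try have Lj' := ltn_ord j'.
all: try have Te := tag_neq _ _ _ _ _ nuv.
all: try by lia.
all: case: Bl => [Ei|[? /negPf ne]|[? /negPf ne]]; try subst i'.
all: rewrite ?[i' == i]eq_sym ?ne ?eqxx //.
all: try by lia.
all: try by have := Te erefl; lia.
by rewrite eqxx in nuv.
Qed.

Lemma ladder_not_B2m : 9 ^ 4 * 2 < n -> 9 ^ 3 < k -> ~ Bm 2 ladder.
Proof.
move=> lt_n lt_k [p [[p_grid p_adj] p_mono]].
have /fin_all_exists[q qE] v : exists q, forall e, used (p v) e <-> on q e.
  by apply: monotonic_staircase; [exact: p_grid | case: (p_mono v) ..].
have touchP (u v : gvert) : u != v -> touch (q u) (q v) <-> gadj u v.
  move=> nuv; rewrite -[gadj u v]/(@adj ladder u v) p_adj //.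
  split=> [[e [/qE ? /qE ?]]|/(share_edgeP _ (p_grid u))[e [/qE ? /qE ?]]].
    by apply/(share_edgeP _ (p_grid u)); exists e.
  by exists e.
have touches u v : gadj u v -> touch (q u) (q v).
  move=> uv; apply/touchP => //; apply: contraTneq uv => ->.
  by rewrite gadj_irrefl.
have apart u v : u != v -> ~~ gadj u v -> ~ touch (q u) (q v).
  by move=> nuv /negP nadj /(touchP _ _ nuv).
apply: (@no_double_crossing 'I_n (q \o rail) (q clasp) (q \o rung)) => /=.
- by rewrite card_ord.
- by move=> i i' nii'; apply: apart.
- exact: apart.
- by move=> b i; apply: touches.
- move=> b i.
  have [|||||j [e [ej ei eP]]] := @triple_edge 'I_k (q \o tag b i) (q (rung i)) (q clasp) (q (guard b)).
  + by rewrite card_ord.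
  + move=> j j' njj'; apply: apart => //.
    by apply: contraNneq njj' => -[->].
  + exact: apart.
  + exact: apart.
  + by move=> j; split; apply: touches; rewrite /gadj /= ?eqxx.
  (* An edge of the tag on the opposite rail would make these two adjacent. *)
  exists e; split=> // erail; apply: (@apart (tag b i j) (rail (~~ b))) => //.
    by rewrite /gadj /=; case: (b).
  by exists e.
Qed.

End Graph.

Theorem theorem3p4 :
  (forall G : sgraph, Bm 2 G -> B 2 G) /\
  (exists G : sgraph, B 2 G /\ ~ Bm 2 G).
Proof.
split=> [G [p [repr mono]] | ].
  by exists p; split=> // v; case: (mono v).
exists (ladder (9 ^ 4 * 2).+1 (9 ^ 3).+1).
by split; [exact: ladder_B2 | exact: ladder_not_B2m].
Qed.
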